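(* Let $\mathbf{C}$ be a simple coop. Then there is a 2-divisible subgroup $\mathbf{G}$ of the additive group of the real numbers such that either (i) $\mathbf{C}$ is isomorphic to $\mathbf{G}_{\ge 0}$, or (ii) $\mathbf{C}$ is isomorphic to $\mathbf{G}_{[0,1]}$.
   Context: A pocrim is a structure $(M;0,+,\rightarrow)$ with a constant $0$ and binary operations $+,\rightarrow$ such that, writing $x\ge y$ as an abbreviation for $x\rightarrow y=0$: $(x+y)+z=x+(y+z)$, $x+y=y+x$, $x+0=x$; $\ge$ is reflexive, transitive and antisymmetric; $x\ge y$ implies $x+z\ge y+z$; $x\ge 0$; and $x+y\ge z$ iff $x\ge y\rightarrow z$. A hoop is a pocrim that is naturally ordered: whenever $x\ge y$ there is $z$ with $x=y+z$. A coop is a structure $(C;0,+,\rightarrow,/2)$ whose $(0,+,\rightarrow)$-reduct is a hoop and in which $x/2=x/2\rightarrow x$ for all $x$. A coop is simple if it admits no non-trivial congruences; equivalently, its only ideals are $\{0\}$ and the whole carrier set, where an ideal is a subset containing $0$, closed under $+$ and downwards closed for $\le$. For a 2-divisible linearly ordered commutative group $\mathbf{G}=(G;0,+,\ge)$, $\mathbf{G}_{\ge 0}$ is the coop whose carrier set is the set of non-negative elements of $G$, with the group's $0$ and $+$, with $x\rightarrow y=\sup\{0,y-x\}$, and with $x/2$ the unique element with $x/2+x/2=x$. For $a\in G$ with $a>0$, $\mathbf{G}_{[0,a]}$ is the coop with carrier set $\{x\in G : 0\le x\le a\}$, with addition $\inf\{a,x+y\}$ and with $0$, $\rightarrow$ and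 $/2$ restricted from $\mathbf{G}_{\ge 0}$. Subgroups of $\mathbb{R}$ carry the usual order; the notation $\mathbf{G}_{[0,1]}$ presupposes $1\in G$. *)

(* Defs.v *)
From HB Require Import structures.
From mathcomp Require Import all_boot all_order all_algebra.
From mathcomp Require Import lra.
Set Implicit Arguments.
Unset Strict Implicit.
Unset Printing Implicit Defensive.
Import Order.TTheory GRing.Theory Num.Theory.
Local Open Scope ring_scope.

(* The order of a pocrim is not primitive: x >= y abbreviates [pimp x y = pzero],
   so that [pimp x y] plays the role of a truncated difference y - x. *)
HB.mixin Record isPocrim (M : Type) := {
  pzero : M;
  padd : M -> M -> M;
  pimp : M -> M -> M;
  padd_assoc : forall x y z, padd (padd x y) z = padd x (padd y z);
  padd_comm : forall x y, padd x y = padd y x;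
  padd_zero : forall x, padd x pzero = x;
  pge_refl : forall x, pimp x x = pzero;
  pge_trans : forall x y z, pimp x y = pzero -> pimp y z = pzero -> pimp x z = pzero;
  pge_anti : forall x y, pimp x y = pzero -> pimp y x = pzero -> x = y;
  pge_add : forall x y z, pimp x y = pzero -> pimp (padd x z) (padd y z) = pzero;
  pge_zero : forall x, pimp x pzero = pzero;
  presiduation : forall x y z,
    pimp (padd x y) z = pzero <-> pimp x (pimp y z) = pzero
}.

#[short(type="pocrimType")]
HB.structure Definition Pocrim := { M of isPocrim M }.

HB.mixin Record Pocrim_isHoop M of Pocrim M := {
  naturally_ordered : forall x y : M,
    pimp x y = pzero -> exists z : M, x = padd y z
}.

#[short(type="hoopType")]
HB.structure Definition Hoop := { M of Pocrim_isHoop M & Pocrim M }.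

HB.mixin Record Hoop_isCoop M of Hoop M := {
  chalf : M -> M;
  half_imp : forall x : M, chalf x = pimp (chalf x) x
}.

#[short(type="coopType")]
HB.structure Definition Coop := { M of Hoop_isCoop M & Hoop M }.

Record coop_congruence (C : coopType) (theta : C -> C -> Prop) : Prop := {
  cong_refl : forall x, theta x x;
  cong_sym : forall x y, theta x y -> theta y x;
  cong_trans : forall x y z, theta x y -> theta y z -> theta x z;
  cong_add : forall x x' y y',
    theta x x' -> theta y y' -> theta (padd x y) (padd x' y');
  cong_imp : forall x x' y y',
    theta x x' -> theta y y' -> theta (pimp x y) (pimp x' y');
  cong_half : forall x x', theta x x' -> theta (chalf x) (chalf x')
}.

(* The one-element coop counts as simple. *)
Definition simple_coop (C : coopType) : Prop :=
  forall theta : C -> C -> Prop, coop_congruence theta ->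
    (forall x y, theta x y <-> x = y) \/ (forall x y, theta x y).

Definition coop_isomorphic (C D : coopType) : Prop :=
  exists f : C -> D,
    [/\ bijective f,
        f pzero = pzero,
        forall x y, f (padd x y) = padd (f x) (f y),
        forall x y, f (pimp x y) = pimp (f x) (f y)
      & forall x, f (chalf x) = chalf (f x)].

Definition two_divisible (V : zmodType) (G : zmodClosed V) : Prop :=
  forall x, x \in G -> exists2 y, y \in G & y + y = x.

Lemma two_divisible_half (R : realFieldType) (G : zmodClosed R) :
  two_divisible G -> forall x, x \in G -> x / 2 \in G.
Proof.
move=> G2 x /G2[y yG <-]; suff -> : (y + y) / 2 = y by [].
lra.
Qed.

(* The carrier of G_{>= 0} does not depend on the proof that G is 2-divisible;
   the phantom argument is there for the coop instance to be inferred. *)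
Section Nonneg.
Variables (R : realFieldType) (G : zmodClosed R) (G2 : two_divisible G).

Definition nonneg_part of two_divisible G : Type :=
  {x : R | (x \in G) && (0 <= x)}.
Local Notation T := (nonneg_part G2).
Implicit Types x y z : T.

Fact nn_zero_subproof : (0 \in G) && (0 <= 0 :> R).
Proof. by rewrite rpred0 lexx. Qed.

Fact nn_add_subproof x y :
  (sval x + sval y \in G) && (0 <= sval x + sval y).
Proof.
case: x y => [x /= /andP[xG x0]] [y /= /andP[yG y0]].
by rewrite rpredD // addr_ge0.
Qed.

Fact nn_imp_subproof x y :
  (Num.max 0 (sval y - sval x) \in G) && (0 <= Num.max 0 (sval y - sval x)).
Proof.
case: x y => [x /= /andP[xG x0]] [y /= /andP[yG y0]].
by case: (leP 0 (y - x)) => [->|_]; rewrite ?rpredB // rpred0 lexx.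
Qed.

Fact nn_half_subproof x : (sval x / 2 \in G) && (0 <= sval x / 2).
Proof.
case: x => [x /= /andP[xG x0]].
by rewrite two_divisible_half // divr_ge0.
Qed.

Definition nn_zero : T := exist _ 0 nn_zero_subproof.
Definition nn_add x y : T := exist _ (sval x + sval y) (nn_add_subproof x y).
Definition nn_imp x y : T :=
  exist _ (Num.max 0 (sval y - sval x)) (nn_imp_subproof x y).
Definition nn_half x : T := exist _ (sval x / 2) (nn_half_subproof x).

Fact nn_geP x y : nn_imp x y = nn_zero <-> sval y <= sval x.
Proof.
split=> [/(congr1 sval)/=|yx].
  by case: (leP 0 (_ - _)) => h e; lra.
by apply: val_inj => /=; case: (leP 0 (_ - _)) => h //; lra.
Qed.

Fact nn_ge0 x : 0 <= sval x.
Proof. by case: x => x /= /andP[]. Qed.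

Fact nn_addA x y z : nn_add (nn_add x y) z = nn_add x (nn_add y z).
Proof. by apply: val_inj; rewrite /= addrA. Qed.

Fact nn_addC x y : nn_add x y = nn_add y x.
Proof. by apply: val_inj; rewrite /= addrC. Qed.

Fact nn_addr0 x : nn_add x nn_zero = x.
Proof. by apply: val_inj; rewrite /= addr0. Qed.

Fact nn_refl x : nn_imp x x = nn_zero.
Proof. exact/nn_geP. Qed.

Fact nn_trans x y z :
  nn_imp x y = nn_zero -> nn_imp y z = nn_zero -> nn_imp x z = nn_zero.
Proof. by move=> /nn_geP xy /nn_geP yz; apply/nn_geP/(le_trans yz). Qed.

Fact nn_anti x y : nn_imp x y = nn_zero -> nn_imp y x = nn_zero -> x = y.
Proof.
by move=> /nn_geP xy /nn_geP yx; apply/val_inj/le_anti; rewrite xy yx.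
Qed.

Fact nn_mono x y z :
  nn_imp x y = nn_zero -> nn_imp (nn_add x z) (nn_add y z) = nn_zero.
Proof. by move=> /nn_geP xy; apply/nn_geP; rewrite /= lerD2r. Qed.

Fact nn_imp0 x : nn_imp x nn_zero = nn_zero.
Proof. exact/nn_geP/nn_ge0. Qed.

Fact nn_residuation x y z :
  nn_imp (nn_add x y) z = nn_zero <-> nn_imp x (nn_imp y z) = nn_zero.
Proof.
have x0 := nn_ge0 x.
by split=> /nn_geP /= h; apply/nn_geP => /=; move: h;
  case: (leP 0 (_ - _)) => h1 h2; lra.
Qed.

Fact nn_natural x y : nn_imp x y = nn_zero -> exists z, x = nn_add y z.
Proof.
move=> /nn_geP yx; exists (nn_imp y x); apply: val_inj => /=.
by case: (leP 0 _) => h; lra.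
Qed.

Fact nn_half_imp x : nn_half x = nn_imp (nn_half x) x.
Proof.
have x0 := nn_ge0 x.
by apply: val_inj => /=; case: (leP 0 _) => h; lra.
Qed.

HB.instance Definition _ := isPocrim.Build T
  nn_addA nn_addC nn_addr0 nn_refl nn_trans nn_anti nn_mono nn_imp0
  nn_residuation.
HB.instance Definition _ := Pocrim_isHoop.Build T nn_natural.
HB.instance Definition _ := Hoop_isCoop.Build T nn_half_imp.

End Nonneg.

(* G_{[0,a]}, with phantom arguments as above.  The addition is truncated at a,
   while 0, pimp and chalf are those of G_{>= 0}. *)
Section Interval.
Variables (R : realFieldType) (G : zmodClosed R) (G2 : two_divisible G).
Variables (a : R) (aG : a \in G) (a_gt0 : 0 < a).

Definition interval_part of two_divisible G & a \in G & 0 < a : Type :=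
  {x : R | [&& x \in G, 0 <= x & x <= a]}.
Local Notation T := (interval_part G2 aG a_gt0).
Implicit Types x y z : T.

Fact itv_zero_subproof : [&& 0 \in G, 0 <= 0 :> R & 0 <= a].
Proof. by rewrite rpred0 lexx ltW. Qed.

Fact itv_add_subproof x y :
  [&& Num.min a (sval x + sval y) \in G, 0 <= Num.min a (sval x + sval y)
    & Num.min a (sval x + sval y) <= a].
Proof.
case: x y => [x /= /and3P[xG x0 xa]] [y /= /and3P[yG y0 ya]].
case: (leP a (x + y)) => h; first by rewrite aG lexx ltW.
by rewrite rpredD // addr_ge0 //= ltW.
Qed.

Fact itv_imp_subproof x y :
  [&& Num.max 0 (sval y - sval x) \in G, 0 <= Num.max 0 (sval y - sval x)
    & Num.max 0 (sval y - sval x) <= a].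
Proof.
case: x y => [x /= /and3P[xG x0 xa]] [y /= /and3P[yG y0 ya]].
case: (leP 0 (y - x)) => h; last exact: itv_zero_subproof.
by rewrite rpredB //= h /=; lra.
Qed.

Fact itv_half_subproof x :
  [&& sval x / 2 \in G, 0 <= sval x / 2 & sval x / 2 <= a].
Proof.
case: x => [x /= /and3P[xG x0 xa]].
by rewrite two_divisible_half // divr_ge0 //=; lra.
Qed.

Definition itv_zero : T := exist _ 0 itv_zero_subproof.
Definition itv_add x y : T :=
  exist _ (Num.min a (sval x + sval y)) (itv_add_subproof x y).
Definition itv_imp x y : T :=
  exist _ (Num.max 0 (sval y - sval x)) (itv_imp_subproof x y).
Definition itv_half x : T := exist _ (sval x / 2) (itv_half_subproof x).

Fact itv_geP x y : itv_imp x y = itv_zero <-> sval y <= sval x.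
Proof.
split=> [/(congr1 sval)/=|yx].
  by case: (leP 0 (_ - _)) => h e; lra.
by apply: val_inj => /=; case: (leP 0 (_ - _)) => h //; lra.
Qed.

Fact itv_ge0 x : 0 <= sval x.
Proof. by case: x => x /= /and3P[]. Qed.

Fact itv_lea x : sval x <= a.
Proof. by case: x => x /= /and3P[]. Qed.

Fact itv_addA x y z : itv_add (itv_add x y) z = itv_add x (itv_add y z).
Proof.
have [[x0 y0] z0] := (itv_ge0 x, itv_ge0 y, itv_ge0 z).
apply: val_inj => /=.
by case: (leP a (sval x + _)) => h1; case: (leP a (sval y + _)) => h2;
  case: (leP a (_ + sval z)) => h3; case: (leP a (sval x + _)) => h4; lra.
Qed.

Fact itv_addC x y : itv_add x y = itv_add y x.
Proof. by apply: val_inj; rewrite /= addrC. Qed.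

Fact itv_addr0 x : itv_add x itv_zero = x.
Proof.
have xa := itv_lea x.
by apply: val_inj; rewrite /= addr0; case: (leP a _) => h; lra.
Qed.

Fact itv_refl x : itv_imp x x = itv_zero.
Proof. exact/itv_geP. Qed.

Fact itv_trans x y z :
  itv_imp x y = itv_zero -> itv_imp y z = itv_zero -> itv_imp x z = itv_zero.
Proof. by move=> /itv_geP xy /itv_geP yz; apply/itv_geP/(le_trans yz). Qed.

Fact itv_anti x y : itv_imp x y = itv_zero -> itv_imp y x = itv_zero -> x = y.
Proof.
by move=> /itv_geP xy /itv_geP yx; apply/val_inj/le_anti; rewrite xy yx.
Qed.

Fact itv_mono x y z :
  itv_imp x y = itv_zero -> itv_imp (itv_add x z) (itv_add y z) = itv_zero.
Proof.
by move=> /itv_geP xy; apply/itv_geP => /=;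
  case: (leP a (sval x + _)) => h1; case: (leP a (sval y + _)) => h2; lra.
Qed.

Fact itv_imp0 x : itv_imp x itv_zero = itv_zero.
Proof. exact/itv_geP/itv_ge0. Qed.

Fact itv_residuation x y z :
  itv_imp (itv_add x y) z = itv_zero <-> itv_imp x (itv_imp y z) = itv_zero.
Proof.
have [[x0 y0] za] := (itv_ge0 x, itv_ge0 y, itv_lea z).
by split=> /itv_geP /= h; apply/itv_geP => /=; move: h;
  case: (leP 0 (_ - _)) => h1; case: (leP a (_ + _)) => h2 h3; lra.
Qed.

Fact itv_natural x y : itv_imp x y = itv_zero -> exists z, x = itv_add y z.
Proof.
move=> /itv_geP yx; exists (itv_imp y x); apply: val_inj => /=.
by have xa := itv_lea x; case: (leP 0 _) => h1; case: (leP a _) => h2; lra.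
Qed.

Fact itv_half_imp x : itv_half x = itv_imp (itv_half x) x.
Proof.
have x0 := itv_ge0 x.
by apply: val_inj => /=; case: (leP 0 _) => h; lra.
Qed.

HB.instance Definition _ := isPocrim.Build T
  itv_addA itv_addC itv_addr0 itv_refl itv_trans itv_anti itv_mono itv_imp0
  itv_residuation.
HB.instance Definition _ := Pocrim_isHoop.Build T itv_natural.
HB.instance Definition _ := Hoop_isCoop.Build T itv_half_imp.

End Interval.

(* Main.v *)
Require Import Defs.
From HB Require Import structures.
From mathcomp Require Import all_boot all_order all_algebra.
From mathcomp Require Import reals.
From mathcomp Require Import boolp classical_sets ring lra zify.
Import Order.TTheory GRing.Theory Num.Theory.
Local Open Scope ring_scope.

(** Simplicity acts through one consequence, the Archimedean property: for
    [a <> 0], being equal up to a multiple of [a] is a congruence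
    ([within_multiple_congruence]) that identifies [a] with [0], so it identifies
    everything, and multiples of [a] exceed every element.

    In an Archimedean hoop, [x ~> y = y] with [x <> 0] forces [y = 0], because
    [y = n x ~> y] for every [n] ([imp_fix_eq0]).  Both the law
    [(x ~> y) ~> y = x] for [x <= y] and linearity ([pge_total]) come from
    applying this to suitable implications.  It follows likewise that a sum
    which absorbs a nonzero element is the greatest element, so addition is
    cancellative except where it reaches the top ([imp_add_or_top]).

    For the embedding in the reals, fix [e <> 0], to be the greatest element
    if there is one, and measure [x] from above by the grids of the multiples
    of [e / 2 ^ n]: [measure x] is the infimum of the [N / 2 ^ n] such that
    [N (e / 2 ^ n) >= x].  Covering from above makes sense even where sums
    are truncated, so the bounded and the unbounded case need no
    distinction.  Subadditivity is immediate.  The converse inequality, for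
    [y = x + (x ~> y)], comes from splitting a cover of [y] at the last grid
    point below [x], which costs one grid step ([measure_split]).  Hence the
    measure turns [~>] into truncated subtraction, and it is injective because
    it gives [e] the value 1 and some multiple of a nonzero element exceeds
    [e].

    The two alternatives are then whether a top exists.  If not, the measure
    is additive and the group is the set of differences of values; if [e] is
    the top, sums are truncated at 1 and the group is the set of integer
    translates of values.  Truncated subtraction shows that these groups have
    no nonnegative elements, respectively no elements of [[0, 1]], beyond the
    values themselves. *)

(** * Arithmetic of pocrims *)

Declare Scope pocrim_scope.
Delimit Scope pocrim_scope with P.
Reserved Notation "x ~> y" (at level 55, right associativity).
Notation "0" := (@pzero _) : pocrim_scope.
Notation "x + y" := (padd x y) : pocrim_scope.
Notation "x ~> y" := (pimp x y) : pocrim_scope.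
Notation "x >= y" := (pimp x y = pzero) : pocrim_scope.

Section PocrimTheory.
Local Open Scope pocrim_scope.
Context {M : pocrimType}.
Implicit Types x y z w : M.

Lemma padd0l x : 0 + x = x.
Proof. by rewrite padd_comm padd_zero. Qed.

Lemma paddCA x y z : x + (y + z) = y + (x + z).
Proof. by rewrite -padd_assoc (padd_comm x) padd_assoc. Qed.

Lemma pge0_eq x : 0 >= x -> x = 0.
Proof. by move=> x0; apply: pge_anti; rewrite ?pge_zero. Qed.

Lemma pge_addr x y : x + y >= x.
Proof.
by have := pge_add _ _ x (pge_zero y); rewrite padd0l padd_comm.
Qed.

Lemma pge_add2 x x' y y' : x >= x' -> y >= y' -> x + y >= x' + y'.
Proof.
move=> xx' yy'; apply: pge_trans (pge_add _ _ y xx') _.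
by rewrite padd_comm (padd_comm x'); apply: pge_add.
Qed.

Lemma pge_imp_app x y : x + (x ~> y) >= y.
Proof. by rewrite padd_comm; apply/presiduation; rewrite pge_refl. Qed.

Lemma pge_imp x y : y >= x ~> y.
Proof. by apply/presiduation; apply: pge_addr. Qed.

Lemma imp_le x y z : x + z >= y -> z >= x ~> y.
Proof. by rewrite padd_comm => /presiduation. Qed.

Lemma imp_mono x x' y y' : x' >= x -> y >= y' -> x ~> y >= x' ~> y'.
Proof.
move=> xx' yy'; apply: imp_le; apply: pge_trans yy'.
by apply: pge_trans (pge_add _ _ _ xx') (pge_imp_app _ _).
Qed.

(** Residuation says that [x ~> _] is left adjoint to [x + _]; adjoints
    compose. *)
Lemma imp_curry x y z : (x + y) ~> z = x ~> y ~> z.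
Proof.
apply: pge_anti.
  do 2 apply: imp_le; rewrite -padd_assoc (padd_comm y); exact: pge_imp_app.
apply: imp_le; rewrite (padd_comm x) padd_assoc.
apply: pge_trans (pge_imp_app y z); apply: pge_add2 (pge_refl _) _.
exact: pge_imp_app.
Qed.

Lemma imp_exch x y z : x ~> y ~> z = y ~> x ~> z.
Proof. by rewrite -imp_curry padd_comm imp_curry. Qed.

Lemma imp0l x : 0 ~> x = x.
Proof.
apply: pge_anti (pge_imp _ _); have := pge_imp_app 0 x; by rewrite padd0l.
Qed.

Lemma imp3 x y : ((x ~> y) ~> y) ~> y = x ~> y.
Proof.
apply: pge_anti; last by apply: imp_le; rewrite padd_comm; apply: pge_imp_app.
apply: imp_mono (pge_refl y); apply: imp_le.
by rewrite padd_comm; apply: pge_imp_app.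
Qed.

Definition pmul n x := iter n (padd x) 0.

Lemma pmul1 x : pmul 1 x = x.
Proof. exact: padd_zero. Qed.

Lemma pmulD m n x : pmul (m + n)%N x = pmul m x + pmul n x.
Proof.
by elim: m => [|m IH]; rewrite ?padd0l //= {1}/pmul /= -/(pmul _ _) IH padd_assoc.
Qed.

Lemma pmulM m n x : pmul (m * n)%N x = pmul m (pmul n x).
Proof. by elim: m => [|m IH] //; rewrite mulSn pmulD IH. Qed.

Lemma pmul_ge m n x : (n <= m)%N -> pmul m x >= pmul n x.
Proof. by move=> /subnKC <-; rewrite pmulD; apply: pge_addr. Qed.

End PocrimTheory.

(** * Congruences of coops *)

Section HoopTheory.
Local Open Scope pocrim_scope.

Lemma add_imp (M : hoopType) (x y : M) : y >= x -> x + (x ~> y) = y.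
Proof.
move=> yx; apply: pge_anti; first exact: pge_imp_app.
have [z ->] := naturally_ordered _ _ yx.
by apply: pge_add2 (pge_refl _) _; apply: imp_le (pge_refl _).
Qed.

(** Both sides are the least upper bound of [x] and [y]: an upper bound [w] of
    [x] and [y] is [x + (x ~> w)], which dominates [x + (x ~> y)]. *)
Lemma join_comm (M : hoopType) (x y : M) : x + (x ~> y) = y + (y ~> x).
Proof.
suff le (u v : M) : u + (u ~> v) >= v + (v ~> u) by apply: pge_anti; apply: le.
have uv := pge_imp_app u v.
rewrite -[X in X >= _](add_imp _ _ _ uv).
apply: pge_add2 (pge_refl _) _; apply: imp_mono (pge_refl _) _.
exact: pge_addr.
Qed.

Lemma half_add (C : coopType) (x : C) : chalf x + chalf x = x.
Proof.
have h := half_imp x; rewrite {2}h; apply: add_imp.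
by rewrite h; apply: pge_imp.
Qed.

Lemma half_eq0 (C : coopType) (x : C) : chalf x = 0 -> x = 0.
Proof. by move=> x0; rewrite -(half_add _ x) x0 padd_zero. Qed.

(** The equation [h = h ~> x] determines [h] by a computation with [+] and [~>]
    alone, so the same computation modulo [theta] shows that any congruence of
    the hoop respects halving. *)
Lemma congruence_half (C : coopType) (theta : C -> C -> Prop) :
    (forall x, theta x x) ->
    (forall x y, theta x y -> theta y x) ->
    (forall x y z, theta x y -> theta y z -> theta x z) ->
    (forall x x' y y', theta x x' -> theta y y' -> theta (x + y) (x' + y')) ->
    (forall x x' y y', theta x x' -> theta y y' -> theta (x ~> y) (x' ~> y')) ->
  forall x x', theta x x' -> theta (chalf x) (chalf x').
Proof.
move=> r s t ad im x x' xx'.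
have := half_imp x; have := half_imp x'.
set h := chalf x; set k := chalf x' => kE hE.
have hx' : theta (h ~> x') h by rewrite {2}hE; apply: im => //; apply: s.
(* Put [t = h ~> k] and [s = k ~> h].  Then [h = s + (s ~> h)] and
   [k = t + (t ~> k)].  Modulo [theta], [t] and [s] agree, both being
   [h ~> k ~> x'], and so do [t ~> h] and [t ~> k], both being the implication
   from the join of [h] and [k] to [x']. *)
have hk_kh : theta (h ~> k) (k ~> h).
  by rewrite {1}kE imp_exch; apply: im.
have imE : theta ((h ~> k) ~> h) ((h ~> k) ~> k).
  apply: t (im _ _ _ _ (r _) (s _ _ hx')) _.
  rewrite [X in theta _ (_ ~> X)]kE -!imp_curry.
  rewrite (padd_comm _ h) join_comm (padd_comm k); apply: im => //.
  by apply: ad => //; apply: s.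
rewrite -(add_imp _ _ _ (pge_imp k h)) -[X in theta _ X](add_imp _ _ _ (pge_imp h k)).
apply: ad; first exact: s.
by apply: t imE; apply: im => //; apply: s.
Qed.

Definition within_multiple (M : pocrimType) (a x y : M) :=
  exists n, x + pmul n a >= y /\ y + pmul n a >= x.

Lemma within_multiple_congruence (C : coopType) (a : C) :
  coop_congruence (within_multiple C a).
Proof.
have r x : within_multiple C a x x by exists 0%N; rewrite padd_zero pge_refl.
have s x y : within_multiple C a x y -> within_multiple C a y x by case=> n [xy yx]; exists n.
have chain x y z m n : x + pmul m a >= y -> y + pmul n a >= z ->
    x + pmul (m + n)%N a >= z.
  move=> xy yz; rewrite pmulD -padd_assoc.
  by apply: pge_trans yz; apply: pge_add.
have t x y z : within_multiple C a x y -> within_multiple C a y z -> within_multiple C a x z.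
  move=> [m [xy yx]] [n [yz zy]]; exists (m + n)%N; split.
    exact: chain xy yz.
  by rewrite addnC; apply: chain zy yx.
have ad x x' y y' : within_multiple C a x x' -> within_multiple C a y y' ->
    within_multiple C a (x + y) (x' + y').
  move=> [m [xx' x'x]] [n [yy' y'y]]; exists (m + n)%N; split.
    by rewrite pmulD padd_assoc (paddCA y) -padd_assoc; apply: pge_add2.
  by rewrite pmulD padd_assoc (paddCA y') -padd_assoc; apply: pge_add2.
have im1 x x' y y' m n : x' + pmul m a >= x -> y + pmul n a >= y' ->
    (x ~> y) + pmul (m + n)%N a >= x' ~> y'.
  move=> x'x yy'; apply: imp_le; apply: pge_trans yy'.
  rewrite pmulD (paddCA _ (pmul m a)) -padd_assoc -padd_assoc.
  apply: pge_add; apply: pge_trans (pge_imp_app x y); exact: pge_add.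
have im x x' y y' : within_multiple C a x x' -> within_multiple C a y y' ->
    within_multiple C a (x ~> y) (x' ~> y').
  by move=> [m [xx' x'x]] [n [yy' y'y]]; exists (m + n)%N; split; apply: im1.
by split=> //; apply: congruence_half.
Qed.

Definition archimedean (M : pocrimType) :=
  forall a x : M, a <> 0 -> exists n, pmul n a >= x.

Lemma simple_archimedean (C : coopType) : simple_coop C -> archimedean C.
Proof.
move=> Csimple a x a0; have [eq|all] := Csimple _ (within_multiple_congruence C a).
  case: a0; apply/eq; exists 1%N; rewrite pge_zero pmul1 padd0l.
  by rewrite pge_refl.
by have [n [nx _]] := all 0 x; exists n; rewrite -[pmul n a]padd0l.
Qed.

End HoopTheory.

(** * Archimedean hoops are linearly ordered *)

Section ArchimedeanHoop.
Local Open Scope pocrim_scope.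
Context {M : hoopType} (arch : archimedean M).
Implicit Types x y z : M.

(** By currying, [n x ~> y = y] for every [n], and some [n x] exceeds [y]. *)
Lemma imp_fix_eq0 x y : x ~> y = y -> x <> 0 -> y = 0.
Proof.
move=> xy /(arch _ y)[n ny].
suff: pmul n x ~> y = y by rewrite ny.
by elim: n {ny} => [|n IH]; [exact: imp0l | rewrite /= imp_curry IH].
Qed.

(** Put [z = (x ~> y) ~> y], which lies below [x].  As [z ~> y = x ~> y], the
    gap [z ~> x] fixes [x ~> y] under implication, so one of them is [0]. *)
Lemma imp_imp_cancel x y : y >= x -> (x ~> y) ~> y = x.
Proof.
move=> yx; set z := _ ~> y.
have xz : x >= z by apply: imp_le; rewrite padd_comm; apply: pge_imp_app.
have fix_e : (z ~> x) ~> (x ~> y) = x ~> y.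
  by rewrite -{1}(imp3 x y) -/z -imp_curry padd_comm add_imp.
have [e0|e0] := pselect (z ~> x = 0); first exact: pge_anti.
have xy : x >= y by apply: imp_fix_eq0 fix_e e0.
by rewrite /z xy imp0l; apply: pge_anti.
Qed.

(** The element [y ~> x] is fixed by [(x ~> y) ~> _].  Indeed, with [u] the join
    of [x] and [y], it is [y ~> u], and exchanging premises turns
    [(x ~> y) ~> (y ~> u)] into [y ~> ((x ~> u) ~> u)], that is, [y ~> x]. *)
Lemma pge_total x y : x >= y \/ y >= x.
Proof.
have [|xy] := pselect (x >= y); first by left.
right; apply: imp_fix_eq0 xy.
pose u := x + (x ~> y).
have ux : u >= x by apply: pge_addr.
have xu : x ~> u = x ~> y.
  apply: pge_anti; last exact/imp_le/pge_refl.
  exact/imp_mono/pge_imp_app/pge_refl.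
have yu : y ~> u = y ~> x.
  rewrite /u join_comm; apply: pge_anti; last exact/imp_le/pge_refl.
  exact/imp_mono/pge_imp_app/pge_refl.
by rewrite -{1}yu imp_exch -xu imp_imp_cancel.
Qed.

(** Absorbing [y] once means absorbing every multiple of [y], and these exceed
    everything. *)
Lemma absorb_top x y z : x + y = x -> y <> 0 -> x >= z.
Proof.
move=> xy /(arch _ z)[n nz]; apply: pge_trans nz.
suff <- : x + pmul n y = x by rewrite padd_comm; apply: pge_addr.
by elim: n => [|n IH]; rewrite ?padd_zero //= -padd_assoc xy.
Qed.

(** The defect between [x ~> (x + y)] and [y] is absorbed by [x + y]. *)
Lemma imp_add_or_top x y : x ~> (x + y) = y \/ forall z, x + y >= z.
Proof.
set w := x ~> _.
have yw : y >= w by apply: imp_le; apply: pge_refl.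
have [d0|d0] := pselect (w ~> y = 0); [by left; apply: pge_anti | right=> z].
apply: absorb_top d0; rewrite -[in LHS](add_imp _ x (x + y)) ?pge_addr //.
by rewrite padd_assoc add_imp.
Qed.

End ArchimedeanHoop.

(** * The dyadic measure of an element *)

Section Measure.
Context (R : realType) {C : coopType} (arch : archimedean C).
Context (e : C) (e0 : e <> pzero).
Implicit Types (x y z : C) (n N k : nat).

Definition unit_frac n : C := iter n (@chalf C) e.

Lemma pmul_unit_frac k n : pmul (2 ^ k) (unit_frac (n + k)) = unit_frac n.
Proof.
elim: k => [|k IH]; first by rewrite pmul1 addn0.
rewrite expnSr pmulM addnS -[pmul 2 _]/(_ + (_ + pzero))%P padd_zero.
by rewrite [unit_frac _.+1]/= half_add IH.
Qed.

Lemma unit_frac_neq0 n : unit_frac n <> pzero.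
Proof. by elim: n => [|n IH] // /half_eq0. Qed.

(** This exact form of the equation [2 ^ n (e / 2 ^ n) = e] rules out that
    truncation lets fewer than [2 ^ n] copies of [e / 2 ^ n] reach [e]. *)
Lemma imp_unit_frac n : (pmul (2 ^ n).-1 (unit_frac n) ~> e)%P = unit_frac n.
Proof.
elim: n => [|n IH]; first exact: imp0l.
have -> : (2 ^ n.+1).-1 = ((2 ^ n).-1 * 2 + 1)%N.
  by have := expn_gt0 2 n; rewrite expnS; lia.
rewrite pmulD pmul1 pmulM padd_comm imp_curry.
have := pmul_unit_frac 1 n; rewrite addn1 => ->.
by rewrite IH -half_imp.
Qed.

Definition grid_bounds x : set R :=
  [set r | exists n N, (pmul N (unit_frac n) >= x)%P /\ r = N%:R / 2 ^+ n].

Definition measure x : R := inf (grid_bounds x).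

Lemma two_exp_gt0 n : 0 < 2 ^+ n :> R.
Proof. exact: exprn_gt0. Qed.

Lemma measure_le x n N :
  (pmul N (unit_frac n) >= x)%P -> measure x <= N%:R / 2 ^+ n.
Proof.
move=> Nx; apply: ge_inf; last by exists n, N.
exists 0 => _ [m [K [_ ->]]]; apply: divr_ge0 => //; exact/ltW/two_exp_gt0.
Qed.

Lemma measure_ge c x :
    (forall n N, (pmul N (unit_frac n) >= x)%P -> c <= N%:R / 2 ^+ n) ->
  c <= measure x.
Proof.
move=> cP; apply: lb_le_inf => [|_ [n [N [Nx ->]]]]; last exact: cP.
by have [N Nx] := arch e x e0; exists (N%:R / 2 ^+ 0), 0%N, N.
Qed.

Lemma measure_ge0 x : 0 <= measure x.
Proof.
apply: measure_ge => n N _; apply: divr_ge0 => //; exact/ltW/two_exp_gt0.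
Qed.

Lemma measure0 : measure pzero = 0.
Proof.
apply: le_anti; rewrite measure_ge0 andbT.
by have := measure_le pzero 0 0 (pge_refl _); rewrite mul0r.
Qed.

Lemma measure_mono x y : (y >= x)%P -> measure x <= measure y.
Proof.
by move=> yx; apply: measure_ge => n N Ny; apply: measure_le; apply: pge_trans yx.
Qed.

Lemma measure_unit : measure e = 1.
Proof.
apply: le_anti; apply/andP; split.
  have := measure_le e 0 1; rewrite pmul1 pge_refl => /(_ erefl).
  by rewrite divr1.
apply: measure_ge => n N Ne; rewrite ler_pdivlMr ?two_exp_gt0 // mul1r.
rewrite -natrX ler_nat leqNgt; apply/negP => Nlt.
apply: (unit_frac_neq0 n); rewrite -(imp_unit_frac n).
by apply: pge_trans Ne; apply: pmul_ge; lia.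
Qed.

Lemma measure_add_le x y : measure (x + y)%P <= measure x + measure y.
Proof.
rewrite -lerBlDr; apply: measure_ge => n N Nx.
rewrite lerBlDr -lerBlDl; apply: measure_ge => n' N' Ny.
rewrite lerBlDl.
have -> : N%:R / 2 ^+ n + N'%:R / 2 ^+ n' =
    (N * 2 ^ n' + N' * 2 ^ n)%N%:R / 2 ^+ (n + n') :> R.
  have [p p'] := (lt0r_neq0 (two_exp_gt0 n), lt0r_neq0 (two_exp_gt0 n')).
  rewrite natrD !natrM !natrX exprD; by field; rewrite ?p ?p'.
apply: measure_le; rewrite pmulD !pmulM pmul_unit_frac addnC pmul_unit_frac.
exact: pge_add2.
Qed.

Lemma measure_pmul_le n x : measure (pmul n x) <= n%:R * measure x.
Proof.
elim: n => [|n IH]; first by rewrite measure0 mul0r.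
apply: le_trans (measure_add_le _ _) _.
by rewrite -natr1 mulrDl mul1r addrC lerD2r.
Qed.

(** If [a] is the least number of grid steps that cover [x], then [a - 1] steps
    stay below [x], so the other [N - (a - 1)] steps cover [x ~> y]. *)
Lemma measure_split x y n N :
    (y >= x)%P -> (pmul N (unit_frac n) >= y)%P ->
  measure x + measure (x ~> y)%P <= (N%:R + 1) / 2 ^+ n.
Proof.
set u := unit_frac n => yx Ny.
have Nx : (pmul N u >= x)%P := pge_trans _ _ _ Ny yx.
have exP : exists a, `[< (pmul a u >= x)%P >] by exists N; apply/asboolP.
case: (ex_minnP exP) => a /asboolP ax amin.
have aN : (a <= N)%N by apply: amin; apply/asboolP.
have xa : (x >= pmul a.-1 u)%P.
  case: a ax amin {aN} => [|a] ax amin; first exact: pge_zero.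
  have [|//] := pge_total arch (pmul a u) x.
  by move=> /asboolP /amin; rewrite ltnn.
have zN : (pmul (N - a.-1) u >= x ~> y)%P.
  apply: imp_le; apply: pge_trans Ny.
  rewrite -[X in pimp _ (pmul X u)](@subnKC a.-1 N); last lia.
  by rewrite pmulD; apply: pge_add.
apply: le_trans (lerD (measure_le _ _ _ ax) (measure_le _ _ _ zN)) _.
rewrite -mulrDl -natrD natr1 ler_pM2r ?invr_gt0 ?two_exp_gt0 // ler_nat; lia.
Qed.

(** A cover of [y] is also a cover on every finer grid, where the extra step of
    [measure_split] is arbitrarily small. *)
Lemma measure_imp_add x y :
  (y >= x)%P -> measure x + measure (x ~> y)%P <= measure y.
Proof.
move=> yx; apply: measure_ge => n N Ny; apply/ler_addgt0Pr => eps eps0.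
pose k := Num.bound eps^-1.
have kN : (pmul (N * 2 ^ k) (unit_frac (n + k)) >= y)%P.
  by rewrite pmulM pmul_unit_frac.
apply: le_trans (measure_split _ _ _ _ yx kN) _.
have [p p'] := (two_exp_gt0 n, two_exp_gt0 k).
have keps : (2 ^+ k)^-1 <= eps.
  rewrite -[eps]invrK lef_pV2 ?posrE ?invr_gt0 //.
  apply: ltW (lt_le_trans (archi_boundP _) _); first by rewrite invr_ge0 ltW.
  by rewrite -natrX ler_nat ltnW // ltn_expl.
rewrite mulrDl mul1r natrM natrX exprD -mulf_div divff ?lt0r_neq0 // mulr1.
rewrite lerD2l invfM; apply: le_trans keps.
apply: ler_piMl; first by rewrite invr_ge0 ltW.
by rewrite invf_le1 // exprn_ege1 // ler1n.
Qed.

Lemma measure_imp x y :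
  measure (x ~> y)%P = Num.max 0 (measure y - measure x).
Proof.
have [xy|yx] := pge_total arch x y.
  rewrite xy measure0; have := measure_mono _ _ xy.
  by case: (leP 0 (measure y - _)); lra.
have := measure_imp_add _ _ yx; have := measure_add_le x (x ~> y)%P.
rewrite add_imp //; have := measure_mono _ _ yx.
by case: (leP 0 (measure y - _)); lra.
Qed.

Lemma measure_eq0 x : measure x = 0 -> x = pzero.
Proof.
move=> x0; apply: contrapT => /(arch _ e)[n ne].
have := le_trans (measure_mono _ _ ne) (measure_pmul_le n x).
by rewrite x0 mulr0 measure_unit ler10.
Qed.

Lemma measure_inj : injective measure.
Proof.
by move=> x y xy; apply: pge_anti; apply: measure_eq0;
  rewrite measure_imp xy subrr maxxx.
Qed.

(** When the sum is not the top, cancellation gives [y = x ~> (x + y)], whose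
    measure is a difference. *)
Lemma measure_add x y :
    measure (x + y)%P = measure x + measure y \/
    (forall z, (x + y >= z)%P) /\ measure (x + y)%P <= measure x + measure y.
Proof.
have [xy|] := imp_add_or_top arch x y; [left | right]; last first.
  by split=> //; apply: measure_add_le.
have := measure_imp x (x + y)%P; rewrite xy.
by have := measure_mono _ _ (pge_addr x y); case: (leP 0 (_ - _)); lra.
Qed.

End Measure.

(** * Recognising a coop of real numbers *)

Lemma pred_zmod_closed (V : zmodType) (P : V -> Prop) :
    P 0 -> (forall r s, P r -> P s -> P (r - s)) ->
  zmod_closed ((fun r => `[< P r >]) : {pred V}).
Proof.
move=> P0 PB; split=> [|r s /asboolP rP /asboolP sP]; apply/asboolP => //.
exact: PB.
Qed.

Definition pred_zmodClosed (V : zmodType) (P : V -> Prop) (P0 : P 0)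
    (PB : forall r s, P r -> P s -> P (r - s)) : zmodClosed V :=
  HB.pack_for (zmodClosed V) ((fun r => `[< P r >]) : {pred V})
    (GRing.isZmodClosed.Build V _ (pred_zmod_closed V P P0 PB)).

Lemma pred_zmodClosedP (V : zmodType) (P : V -> Prop) P0 PB r :
  reflect (P r) (r \in pred_zmodClosed V P P0 PB).
Proof. exact: asboolP. Qed.

Lemma bijective_of_inj_surj (T U : Type) (g : T -> U) :
  injective g -> (forall u, exists t, g t = u) -> bijective g.
Proof.
move=> g_inj /choice[h hK]; exists h => // t; exact/g_inj/hK.
Qed.

Section Realisation.
Context (R : realFieldType) {C : coopType} (f : C -> R) (f_inj : injective f).
Context (f_imp : forall x y, f (x ~> y)%P = Num.max 0 (f y - f x)).

Lemma realisation_ge0 x : 0 <= f x.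
Proof. by rewrite -[x]imp0l f_imp le_max lexx. Qed.

Lemma realisation_zero : f pzero = 0.
Proof. by rewrite -(pge_refl (pzero : C)) f_imp subrr maxxx. Qed.

Lemma realisation_half x : f (chalf x) = f x / 2.
Proof.
have := congr1 f (half_imp x); rewrite f_imp.
have := realisation_ge0 x; have := realisation_ge0 (chalf x).
by case: (leP 0 (_ - _)); lra.
Qed.


(** A nonnegative difference [f x - f y] is the value [f (y ~> x)]. *)
Lemma additive_realisation :
    (forall x y, f (x + y)%P = f x + f y) ->
  exists (G : zmodClosed R) (G2 : two_divisible G),
    coop_isomorphic C (nonneg_part G2).
Proof.
move=> f_add.
pose P r := exists x y, r = f x - f y.
have P0 : P 0 by exists pzero, pzero; rewrite subrr.
have PB r s : P r -> P s -> P (r - s).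
  move=> [x [y ->]] [x' [y' ->]]; exists (x + y')%P, (y + x')%P.
  by rewrite !f_add; lra.
pose G := pred_zmodClosed R P P0 PB.
have G2 : two_divisible G.
  move=> _ /pred_zmodClosedP[x [y ->]]; exists (f (chalf x) - f (chalf y)).
    by apply/pred_zmodClosedP; exists (chalf x), (chalf y).
  by rewrite !realisation_half; lra.
exists G, G2.
have fG x : (f x \in G) && (0 <= f x).
  rewrite realisation_ge0 andbT; apply/pred_zmodClosedP; exists x, pzero.
  by rewrite realisation_zero subr0.
pose F x : nonneg_part G2 := exist _ (f x) (fG x).
exists F; split=> [||x y|x y|x].
- apply: bijective_of_inj_surj => [x y /(congr1 val)/f_inj //|[r rP]].
  have /andP[/pred_zmodClosedP[x [y rE]] r0] := rP.
  exists (y ~> x)%P; apply: val_inj; rewrite /= f_imp -rE.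
  exact/max_idPr.
- by apply: val_inj; rewrite /= realisation_zero.
- by apply: val_inj; rewrite /= f_add.
- by apply: val_inj; rewrite /= f_imp.
- by apply: val_inj; rewrite /= realisation_half.
Qed.

(** Integer translates of values form a group since [- f z] is
    [f (z ~> e) - 1]. *)
Lemma truncated_realisation (e : C) :
    f e = 1 -> (forall x y, f (x + y)%P = Num.min 1 (f x + f y)) ->
  exists (G : zmodClosed R) (G2 : two_divisible G) (G1 : 1 \in G),
    coop_isomorphic C (interval_part G2 G1 ltr01).
Proof.
move=> fe f_add.
have f_le1 x : f x <= 1.
  by rewrite -[x]padd_zero f_add ge_min lexx.
pose P r := exists x (k : int), r = f x + k%:~R.
have P0 : P 0 by exists pzero, 0; rewrite realisation_zero addr0.
have PB r s : P r -> P s -> P (r - s).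
  move=> [x [k ->]] [y [l ->]]; have [yx|xy] := leP (f y) (f x).
    exists (y ~> x)%P, (k - l); rewrite f_imp intrB.
    by case: (leP 0 (_ - _)); lra.
  (* Here [f x - f y = - f (x ~> y)]. *)
  exists ((x ~> y) ~> e)%P, (k - l - 1); rewrite !f_imp fe !intrB.
  have := realisation_ge0 x; have := f_le1 y.
  by case: (leP 0 (f y - f x)) => h; case: (leP 0 (1 - _)); lra.
pose G := pred_zmodClosed R P P0 PB.
have fG x : f x \in G by apply/pred_zmodClosedP; exists x, 0; rewrite addr0.
have G2 : two_divisible G.
  move=> _ /pred_zmodClosedP[x [k ->]]; exists (f (chalf x) + f (chalf e) *~ k).
    by rewrite rpredD // rpredMz.
  by rewrite -mulrzr !realisation_half fe; lra.
have G1 : 1 \in G by rewrite -fe.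
exists G, G2, G1.
have fI x : [&& f x \in G, 0 <= f x & f x <= 1].
  by rewrite fG realisation_ge0 f_le1.
pose F x : interval_part G2 G1 ltr01 := exist _ (f x) (fI x).
exists F; split=> [||x y|x y|x].
- apply: bijective_of_inj_surj => [x y /(congr1 val)/f_inj //|[r rP]].
  have /and3P[/pred_zmodClosedP[x [k rE]] r0 r1] := rP.
  suff [y yr] : exists y, f y = r by exists y; apply: val_inj.
  have := f_le1 x; have := realisation_ge0 x => x0 x1.
  have k1 : k <= 1 by rewrite -(ler_int R); lra.
  have k0 : -1 <= k by rewrite -(ler_int R); lra.
  have : [|| k == -1, k == 0 | k == 1] by lia.
  case/or3P=> /eqP kE; move: rE; rewrite kE => rE.
  + by exists pzero; rewrite realisation_zero; lra.
  + by exists x; lra.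
  + by exists e; rewrite fe; lra.
- by apply: val_inj; rewrite /= realisation_zero.
- by apply: val_inj; rewrite /= f_add.
- by apply: val_inj; rewrite /= f_imp.
- by apply: val_inj; rewrite /= realisation_half.
Qed.

End Realisation.

(** * Simple coops *)

Theorem theorem24 (R : realType) (C : coopType) (C_simple : simple_coop C) :
  exists (G : zmodClosed R) (G2 : two_divisible G),
    coop_isomorphic C (nonneg_part G2) \/
    (exists G1 : 1 \in G, coop_isomorphic C (interval_part G2 G1 ltr01)).
Proof.
have arch := simple_archimedean C C_simple.
have additive (f : C -> R) : injective f ->
    (forall x y, f (x ~> y)%P = Num.max 0 (f y - f x)) ->
    (forall x y, f (x + y)%P = f x + f y) ->
    exists (G : zmodClosed R) (G2 : two_divisible G),
      coop_isomorphic C (nonneg_part G2) \/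
      (exists G1 : 1 \in G, coop_isomorphic C (interval_part G2 G1 ltr01)).
  move=> f_inj f_imp f_add.
  have [G [G2 iso]] := additive_realisation R f f_inj f_imp f_add.
  by exists G, G2; left.
have [[e e0]|trivial] := pselect (exists e : C, e <> pzero); last first.
  have all0 (x : C) : x = pzero.
    by apply: contrapT => x0; apply: trivial; exists x.
  apply: (additive (fun=> 0)) => [x y _|x y|x y].
  - by rewrite (all0 x) (all0 y).
  - by rewrite subrr maxxx.
  - by rewrite addr0.
have [[t t_top]|no_top] := pselect (exists t : C, forall x, (t >= x)%P).
  have t0 : t <> pzero by move=> tE; apply/e0/pge0_eq; move: (t_top e); rewrite tE.
  have ft := measure_unit R arch t t0.
  have f_add x y : measure R t (x + y)%P =
      Num.min 1 (measure R t x + measure R t y).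
    have [add|[top le]] := measure_add R arch t t0 x y.
      have := measure_mono R arch t t0 _ _ (t_top (x + y)%P).
      by rewrite ft add; case: (leP 1 _); lra.
    have top1 : (x + y)%P = t by apply: pge_anti.
    by move: le; rewrite top1 ft; case: (leP 1 _); lra.
  have [G [G2 [G1 iso]]] := truncated_realisation R (measure R t)
    (measure_inj R arch t t0) (measure_imp R arch t t0) t ft f_add.
  by exists G, G2; right; exists G1.
apply: (additive (measure R e)).
- exact: measure_inj.
- exact: measure_imp.
- move=> x y; have [//|[top _]] := measure_add R arch e e0 x y.
  by case: no_top; exists (x + y)%P.
Qed.
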